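(* Let $\mathbb{O} = \{y\in\mathbb{R}^n : A y \preceq_{\mathcal K} b\}$ be an obstacle, where $A\in\mathbb{R}^{l\times n}$, $b\in\mathbb{R}^l$, $\mathcal K\subset\mathbb{R}^l$ is a closed convex pointed cone with non-empty interior, and $\mathbb{O}$ is a convex compact set with non-empty relative interior. Let the controlled object at state $x\in\mathbb{R}^{n_x}$ occupy the set $\mathbb{E}(x) = R(x)\mathbb{B}+t(x)$, where $R(x)\in\mathbb{R}^{n\times n}$ is an (orthogonal) rotation matrix, $t(x)\in\mathbb{R}^n$ is a translation vector, and $\mathbb{B}=\{y\in\mathbb{R}^n : G y\preceq_{\bar{\mathcal K}} g\}$ is a convex compact set with non-empty relative interior, with $G\in\mathbb{R}^{h\times n}$, $g\in\mathbb{R}^h$, and $\bar{\mathcal K}\subset\mathbb{R}^h$ a closed convex pointed cone. Let $\|\cdot\|$ be a norm on $\mathbb{R}^n$ with dual norm $\|\cdot\|_*$, and let $\mathsf{d}_{\min}\ge 0$. Then $$\mathrm{dist}(\mathbb{E}(x),\mathbb{O}) > \mathsf{d}_{\min}$$ if and only if there exist $\lambda\succeq_{\mathcal K^*}0$ and $\mu\succeq_{\bar{\mathcal K}^*}0$ such that $$-g^\top\mu + (A t(x)-b)^\top\lambda > \mathsf{d}_{\min},\qquad G^\top\mu + R(x)^\top A^\top\lambda = 0,\qquad \|A^\top\lambda\|_*\le 1.$$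
   Context: For a cone $\mathcal K$ in a Euclidean space and vectors $a,c$ in that space, $a\preceq_{\mathcal K} c$ means $c-a\in\mathcal K$. $\mathcal K^*=\{\lambda : \lambda^\top s\ge 0 \text{ for all } s\in\mathcal K\}$ is the dual cone, and $\lambda\succeq_{\mathcal K^*}0$ means $\lambda\in\mathcal K^*$; likewise for $\bar{\mathcal K}$. The dual norm is $\|z\|_*=\max\{z^\top y : \|y\|\le 1\}$. For sets $\mathbb{E},\mathbb{O}\subset\mathbb{R}^n$, the distance is $\mathrm{dist}(\mathbb{E},\mathbb{O}) := \min_{t\in\mathbb{R}^n}\{\|t\| : (\mathbb{E}+t)\cap\mathbb{O}\neq\emptyset\}$. The maps $R:\mathbb{R}^{n_x}\to\mathbb{R}^{n\times n}$ and $t:\mathbb{R}^{n_x}\to\mathbb{R}^n$ are assumed smooth. *)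

(* Defs.v *)
(* R^m is 'cV[R]_m for a realType R, with its usual (product) topology. *)
From HB Require Import structures.
From mathcomp Require Import all_boot all_order all_algebra.
From mathcomp Require Import all_classical all_reals all_analysis.
Import Order.TTheory GRing.Theory Num.Theory.
Import numFieldNormedType.Exports.

Set Implicit Arguments.
Unset Strict Implicit.
Unset Printing Implicit Defensive.

Local Open Scope classical_set_scope.
Local Open Scope ring_scope.

Section Cones.
Context {R : realType} {m : nat}.
Implicit Types (K S : set 'cV[R]_m) (a c u v : 'cV[R]_m).

Definition dotv u v : R := (u^T *m v) 0 0.

Definition is_cone K := forall (a : R) v, 0 <= a -> K v -> K (a *: v).

Definition pointed_cone K := forall v, K v -> K (- v) -> v = 0.

Record closed_convex_pointed_cone K : Prop := ClosedConvexPointedCone {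
  ccp_cone : is_cone K;
  ccp_closed : closed K;
  ccp_convex : convex_set K;
  ccp_pointed : pointed_cone K }.

Definition cone_le K a c := K (c - a).

Definition dual_cone K : set 'cV[R]_m :=
  [set lam | forall s, K s -> 0 <= dotv lam s].

Definition affine_set S :=
  forall u v (a : R), S u -> S v -> S (a *: u + (1 - a) *: v).

Definition affine_hull S : set 'cV[R]_m := smallest affine_set S.

Definition relative_interior S : set 'cV[R]_m :=
  [set y | S y /\ \forall z \near y, affine_hull S z -> S z].

End Cones.

Definition conic_set {R : realType} {m n : nat} (K : set 'cV[R]_m)
    (A : 'M[R]_(m, n)) (b : 'cV[R]_m) : set 'cV[R]_n :=
  [set y | cone_le K (A *m y) b].

Section Norms.
Context {R : realType} {n : nat}.
Implicit Types (N : 'cV[R]_n -> R) (E O : set 'cV[R]_n).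

(* An arbitrary norm; it is unrelated to the sup norm `|_| that MathComp-Analysis
   puts on matrices. Nonnegativity follows from the three axioms. *)
Record is_norm N : Prop := IsNorm {
  is_norm_triangle : forall u v, N (u + v) <= N u + N v;
  is_norm_scale : forall (a : R) v, N (a *: v) = `|a| * N v;
  is_norm_eq0 : forall v, N v = 0 -> v = 0 }.

(* The supremum is a maximum when N is a norm. *)
Definition dual_norm N (z : 'cV[R]_n) : \bar R :=
  ereal_sup [set (dotv z y)%:E | y in [set y | N y <= 1]].

(* The infimum is a minimum when N is a norm and E, O are nonempty and compact. *)
Definition set_dist N E O : \bar R :=
  ereal_inf [set (N t)%:E | t in
    [set t | [set e + t | e in E] `&` O !=set0]].

Definition rotation_mx (M : 'M[R]_n) := M^T *m M = 1%:M /\ \det M = 1.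

End Norms.

Section Smooth.
Context {R : realType} {U V : normedModType R}.

Fixpoint Ck (k : nat) (f : U -> V) : Prop :=
  if k is k'.+1 then
    (forall x, differentiable f x) /\ (forall v, Ck k' (fun x => 'D_v f x))
  else continuous f.

(* For U of finite dimension this is the usual class C^oo. *)
Definition smooth (f : U -> V) := forall k, Ck k f.

End Smooth.

(* Main.v *)
Require Import Defs.
From mathcomp Require Import all_boot all_order all_algebra.
From mathcomp Require Import all_classical all_reals all_analysis.
From mathcomp Require Import lra ring.
Import Order.TTheory GRing.Theory Num.Theory.
Import numFieldNormedType.Exports.

Set Implicit Arguments.
Unset Strict Implicit.
Unset Printing Implicit Defensive.

Local Open Scope classical_set_scope.
Local Open Scope ring_scope.

(** The theorem is conic duality for the distance problem
      minimise N s  subject to  g - G y in Kbar,  b - A (Rot y + t + s) in K.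
    Because the inequality with dmin is strict, what is at stake is the absence
    of a duality gap, not attainment of the dual optimum; the reason that there
    is no gap is compactness, not a constraint qualification.

    Certificates bound the distance from below by weak duality: if s translates
    a point of E x into the obstacle, pairing the two conic constraints with
    lam and mu shows that the dual objective is at most the pairing of A^T lam
    with - s, hence at most N s by [dotv_le_dual_norm].

    Conversely, pick d strictly between dmin and the distance. With
    H = A Rot and c = b - A t, the system
      N s <= d,  g - G y in Kbar,  c - (H y + A s) in K
    has no solution, and [conic_alternative] produces multipliers. They come
    from separating 0 from the set of all residuals
      (H y + A s + k - c, G y + k' - g),  N s <= d, k in K, k' in Kbar,
    for which that set has to be closed. This is where compactness enters. Add
    a homogenising coordinate tau, so that the residuals become a linear map T
    on a closed convex cone C, sliced at tau = 1. A kernel element of T in C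
    with tau > 0 would solve the system after division by tau; one with tau = 0
    has s = 0 and gives a recession direction y of B, which vanishes because B
    is bounded ([compact_no_recession]). So T v = 0 only for v = 0 in C, and by
    compactness of the unit sphere |T v|^2 dominates a multiple of |v|^2 on C
    ([homogeneous_coercive]). Its minimum over the slice is therefore attained,
    and the value of T at the minimiser is the normal of a separating
    hyperplane ([image_separation]).

    For all s with N s <= d the multipliers satisfy
      0 < val + <A^T lam, s>,
    where val is the dual objective. Scaling them by d / val makes the objective
    equal to d > dmin, and the same inequality at - d y for N y <= 1 says that
    the scaled A^T lam has dual norm at most 1. *)

(** * The Euclidean pairing *)

Section DotProduct.
Context {R : realType} {m : nat}.
Implicit Types u v w : 'cV[R]_m.

Lemma dotvE u v : dotv u v = \sum_i u i 0 * v i 0.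
Proof. by rewrite /dotv mxE; apply: eq_bigr => i _; rewrite mxE. Qed.

Lemma dotvC u v : dotv u v = dotv v u.
Proof. by rewrite !dotvE; apply: eq_bigr => i _; rewrite mulrC. Qed.

Lemma dotvDr u v w : dotv u (v + w) = dotv u v + dotv u w.
Proof. by rewrite /dotv mulmxDr mxE. Qed.

Lemma dotvZr (a : R) u v : dotv u (a *: v) = a * dotv u v.
Proof. by rewrite /dotv -scalemxAr mxE. Qed.

Lemma dotvNr u v : dotv u (- v) = - dotv u v.
Proof. by rewrite /dotv mulmxN mxE. Qed.

Lemma dotvBr u v w : dotv u (v - w) = dotv u v - dotv u w.
Proof. by rewrite dotvDr dotvNr. Qed.

Lemma dotv0r u : dotv u 0 = 0.
Proof. by rewrite /dotv mulmx0 mxE. Qed.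

Lemma dotvDl u v w : dotv (v + w) u = dotv v u + dotv w u.
Proof. by rewrite dotvC dotvDr !(dotvC u). Qed.

Lemma dotvZl (a : R) u v : dotv (a *: v) u = a * dotv v u.
Proof. by rewrite dotvC dotvZr dotvC. Qed.

Lemma dotvv_ge0 v : 0 <= dotv v v.
Proof. by rewrite dotvE sumr_ge0// => i _; rewrite -expr2 sqr_ge0. Qed.

Lemma dotvv_eq0 v : dotv v v = 0 -> v = 0.
Proof.
rewrite dotvE => /eqP; rewrite psumr_eq0 => [/allP v0|i _]; last first.
  by rewrite -expr2 sqr_ge0.
apply/matrixP => i j; rewrite (ord1 j) mxE.
have /implyP/(_ isT) := v0 i (mem_index_enum i).
by rewrite mulf_eq0 orbb => /eqP.
Qed.

Lemma dotvv_gt0 v : v != 0 -> 0 < dotv v v.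
Proof.
move=> v0; rewrite lt_neqAle dotvv_ge0 andbT eq_sym.
by apply: contra v0 => /eqP/dotvv_eq0 ->.
Qed.

End DotProduct.

Lemma dotv_mulmx {R : realType} (m n : nat) (M : 'M[R]_(m, n)) u v :
  dotv u (M *m v) = dotv (M^T *m u) v.
Proof. by rewrite /dotv trmx_mul trmxK mulmxA. Qed.

Lemma dotv_col_mx {R : realType} (m1 m2 : nat) (u1 v1 : 'cV[R]_m1)
    (u2 v2 : 'cV[R]_m2) :
  dotv (col_mx u1 u2) (col_mx v1 v2) = dotv u1 v1 + dotv u2 v2.
Proof. by rewrite /dotv tr_col_mx mul_row_col mxE. Qed.

(** * Continuity of matrix-valued maps *)

Section Continuity.
Context {R : realType} {T : topologicalType}.

Lemma continuous_mx (m n : nat) (f : T -> 'M[R]_(m, n)) :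
  (forall i j, continuous (fun t => f t i j)) -> continuous f.
Proof.
move=> fc t; apply/cvgrPdist_lt => e e0.
have : \forall s \near t, forall ij : 'I_m * 'I_n,
    `|f t ij.1 ij.2 - f s ij.1 ij.2| < e.
  apply: filter_forall => -[i j] /=.
  by have /cvgrPdist_lt/(_ e e0) := fc i j t.
apply: filterS => s fts.
have : ball (f t) e (f s).
  by split=> // i j; rewrite /ball/= /ball_; exact: (fts (i, j)).
by rewrite mx_norm_ball.
Qed.

Lemma continuous_entry (m n : nat) (f : T -> 'M[R]_(m, n)) i j :
  continuous f -> continuous (fun t => f t i j).
Proof.
by move=> fc t; apply: continuous_comp (fc t) (@coord_continuous _ _ _ _ _ _).
Qed.

Lemma continuous_sumr (I : Type) (r : seq I) (f : I -> T -> R) :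
  (forall i, continuous (f i)) -> continuous (fun t => \sum_(i <- r) f i t).
Proof.
move=> fc; elim: r => [|i r IHr] t.
  by under eq_fun do rewrite big_nil; exact: cvg_cst.
by under eq_fun do rewrite big_cons; apply: cvgD; [exact: fc|exact: IHr].
Qed.

Lemma continuous_mulmx (m n p : nat) (M : 'M[R]_(m, n))
    (f : T -> 'M[R]_(n, p)) :
  continuous f -> continuous (fun t => M *m f t).
Proof.
move=> fc; apply: continuous_mx => i j.
under eq_fun do rewrite mxE.
apply: continuous_sumr => k t; apply: cvgM; first exact: cvg_cst.
exact: continuous_entry.
Qed.

Lemma continuous_col_mx (m1 m2 n : nat) (f : T -> 'M[R]_(m1, n))
    (g : T -> 'M[R]_(m2, n)) :
  continuous f -> continuous g -> continuous (fun t => col_mx (f t) (g t)).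
Proof.
move=> fc gc; apply: continuous_mx => i j; under eq_fun do rewrite mxE.
by case: (fintype.split i) => k; exact: continuous_entry.
Qed.

Lemma continuous_dotv (m : nat) (f g : T -> 'cV[R]_m) :
  continuous f -> continuous g -> continuous (fun t => dotv (f t) (g t)).
Proof.
move=> fc gc; under eq_fun do rewrite dotvE.
by apply: continuous_sumr => i t; apply: cvgM; exact: continuous_entry.
Qed.

End Continuity.

Section ContinuousProjections.
Context {T U W : topologicalType} (f : T -> U * W).
Hypothesis fc : continuous f.

Lemma continuous_fst : continuous (fun t => (f t).1).
Proof.
move=> t; apply: (@continuous_comp _ _ _ f fst); first exact: fc.
exact: cvg_fst.
Qed.

Lemma continuous_snd : continuous (fun t => (f t).2).
Proof.
move=> t; apply: (@continuous_comp _ _ _ f snd); first exact: fc.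
exact: cvg_snd.
Qed.

End ContinuousProjections.

(** * Spaces whose closed balls are compact *)

Section CompactBalls.
Context {R : realType}.

Definition proper_normed (V : normedModType R) :=
  forall r : R, compact [set v : V | `|v| <= r].

Lemma proper_scalar : proper_normed R^o.
Proof.
move=> r; rewrite (_ : [set _ | _] = `[- r, r]%classic).
  exact: (@segment_compact R).
by apply/seteqP; split => v /=; rewrite in_itv /= ler_norml.
Qed.

(** Transposition is a continuous isometry, hence carries the Heine-Borel
    theorem from row vectors over to column vectors. *)
Lemma proper_cV m : proper_normed 'cV[R]_m.
Proof.
move=> r.
have -> : [set v : 'cV[R]_m | `|v| <= r] =
          [set w^T | w in [set w : 'rV[R]_m | `|w^T| <= r]].
  apply/seteqP; split => [v vr|_ [w wr <-]//].
  by exists v^T => /=; rewrite trmxK.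
have trc : continuous (fun w : 'rV[R]_m => w^T : 'cV[R]_m).
  apply: continuous_mx => i j; under eq_fun do rewrite mxE.
  exact: coord_continuous.
refine (continuous_compact (continuous_subspaceT trc) _).
apply: bounded_closed_compact.
  exists r; split=> [|M rM w /= wr]; first exact: num_real.
  apply: le_trans (le_trans wr (ltW rM)).
  rewrite [leLHS]/Num.norm/= mx_normrE; apply/bigmax_leP; split => // -[i j] _ /=.
  rewrite [leRHS]/Num.norm/= mx_normrE; apply/bigmax_geP; right.
  by exists (j, i) => //=; rewrite mxE.
refine (@preimage_closed _ _ (fun w : 'rV[R]_m => `|w^T|) [set x | x <= r] _ _).
  by move=> w _; apply: continuous_comp; [exact: trc|exact: norm_continuous].
exact: closed_le.
Qed.

Lemma proper_prod (U V : normedModType R) :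
  proper_normed U -> proper_normed V -> proper_normed (U * V)%type.
Proof.
move=> hU hV r.
rewrite (_ : [set _ | _] = [set u : U | `|u| <= r] `*` [set v : V | `|v| <= r]).
  exact: compact_setX.
by apply/seteqP; split => -[u v] /=; rewrite prod_normE/= ge_max => /andP.
Qed.

End CompactBalls.

(** * Separation of a slice of a cone from the kernel of a linear map *)

Section Separation.
Context {R : realType} (V : normedModType R).
Hypothesis properV : proper_normed V.
Variable C : set V.
Hypothesis closedC : closed C.
Hypothesis coneC : forall (a : R) v, 0 <= a -> C v -> C (a *: v).

(** By homogeneity the bound need only hold on the unit vectors of C, a compact
    set on which the continuous F has a positive minimum. *)
Lemma homogeneous_coercive (F : V -> R) :
  continuous F -> (forall (a : R) v, F (a *: v) = a ^+ 2 * F v) ->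
  (forall v, C v -> v != 0 -> 0 < F v) ->
  exists2 c : R, 0 < c & forall v, C v -> c * `|v| ^+ 2 <= F v.
Proof.
move=> Fc Fhom Fpos.
have F0 : F 0 = 0 by rewrite -(scale0r 0) Fhom expr0n mul0r.
pose S := C `&` [set v | `|v| = 1].
have normalize v : C v -> v != 0 -> S (`|v|^-1 *: v).
  move=> Cv v0; split; first by apply: coneC => //; rewrite invr_ge0.
  by rewrite /= normrZ normfV normr_id mulVf// normr_eq0.
have [S0|S0] := pselect (S !=set0); last first.
  exists 1 => // v Cv; have [->|v0] := eqVneq v 0.
    by rewrite normr0 expr0n mulr0 F0.
  by exfalso; apply: S0; exists (`|v|^-1 *: v); exact: normalize.
have closedS : closed S.
  apply: closedI => //.
  refine (@preimage_closed _ _ (@Num.norm R V) [set x | x = 1] _ _).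
    by move=> v _; exact: norm_continuous.
  exact: closed_eq.
have compactS : compact S.
  by refine (subclosed_compact closedS (properV (r := 1)) _) => v [_ /= ->].
have [v1 v1S v1min] := compact_EVT_min S0 compactS (continuous_subspaceT Fc).
move: v1S; rewrite inE => -[Cv1 v11].
exists (F v1).
  apply: Fpos => //; apply/eqP => v10; move: v11; rewrite v10/= normr0 => /eqP.
  by rewrite eq_sym oner_eq0.
move=> v Cv; have [->|v0] := eqVneq v 0.
  by rewrite normr0 expr0n mulr0 F0.
have := v1min (`|v|^-1 *: v); rewrite inE => /(_ (normalize _ Cv v0)).
by rewrite Fhom exprVn mulrC ler_pdivlMr// exprn_gt0// normr_gt0.
Qed.

(** Coercivity confines the minimisation to a ball, which is compact. *)
Lemma homogeneous_attains_min (F : V -> R) (D : set V) :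
  continuous F -> (forall (a : R) v, F (a *: v) = a ^+ 2 * F v) ->
  (forall v, C v -> v != 0 -> 0 < F v) ->
  closed D -> D `<=` C -> D !=set0 ->
  exists2 v0, D v0 & forall v, D v -> F v0 <= F v.
Proof.
move=> Fc Fhom Fpos closedD DC [w Dw].
have [c c0 cF] := homogeneous_coercive Fc Fhom Fpos.
have Fw0 : 0 <= F w.
  by apply: le_trans (cF _ (DC _ Dw)); rewrite mulr_ge0 ?exprn_ge0// ltW.
(* As M >= 1, a vector longer than M has c |v|^2 > c M >= F w. *)
pose M := 1 + F w / c.
have M1 : 1 <= M by rewrite lerDl divr_ge0// ltW.
have large v : D v -> M < `|v| -> F w < F v.
  move=> Dv vM; apply: lt_le_trans (cF _ (DC _ Dv)).
  rewrite mulrC -ltr_pdivrMr//.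
  have : F w / c < M by rewrite /M ltrDr.
  move=> /lt_le_trans; apply; nra.
have closedDM : closed (D `&` [set v | `|v| <= M]).
  apply: closedI => //.
  refine (@preimage_closed _ _ (@Num.norm R V) [set x | x <= M] _ _).
    by move=> v _; exact: norm_continuous.
  exact: closed_le.
have compactDM := subclosed_compact closedDM (properV (r := M))
  (@subIsetr _ _ _).
have DMw : (D `&` [set v | `|v| <= M]) w.
  by split => //=; rewrite leNgt; apply/negP => /(large _ Dw); rewrite ltxx.
have DM0 : D `&` [set v | `|v| <= M] !=set0 by exists w.
have [v0] := compact_EVT_min DM0 compactDM (continuous_subspaceT Fc).
rewrite inE => -[Dv0 _] v0min; exists v0 => // v Dv.
have [vM|vM] := leP `|v| M.
  by apply: v0min; rewrite inE.
by apply: le_trans (ltW (large _ Dv vM)); apply: v0min; rewrite inE.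
Qed.

(** The vector q is the point of least Euclidean norm in the image of D. That
    this point exists is the content of the kernel condition: without it the
    image of the closed set D might fail to be closed. *)
Lemma image_separation (m : nat) (T : V -> 'cV[R]_m) (D : set V) :
  linear T -> continuous T -> (forall v, C v -> T v = 0 -> v = 0) ->
  closed D -> D `<=` C -> ~ D 0 ->
  (forall u v (a : R), 0 <= a <= 1 ->
    D u -> D v -> D (a *: u + (1 - a) *: v)) ->
  exists q : 'cV[R]_m, forall v, D v -> 0 < dotv q (T v).
Proof.
move=> Tlin Tc Tker closedD DC D0 Dconv.
have T0 : T 0 = 0.
  have := Tlin 1 0 0; rewrite !scale1r addr0.
  by move/(congr1 (fun z => z - T 0)); rewrite subrr addrK => <-.
have TZ a v : T (a *: v) = a *: T v by rewrite -[a *: v]addr0 Tlin T0 addr0.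
pose F v := dotv (T v) (T v).
have [Dn0|Dn0] := pselect (D !=set0); last first.
  by exists 0 => v Dv; exfalso; apply: Dn0; exists v.
have Fpos v : C v -> v != 0 -> 0 < F v.
  by move=> Cv v0; apply: dotvv_gt0; apply: contra v0 => /eqP/(Tker _ Cv) ->.
have Fhom a v : F (a *: v) = a ^+ 2 * F v.
  by rewrite /F TZ dotvZr dotvZl mulrA.
have [v0 Dv0 v0min] := homogeneous_attains_min (continuous_dotv Tc Tc)
  Fhom Fpos closedD DC Dn0.
exists (T v0) => w Dw.
have P0 : 0 < F v0.
  by apply: Fpos; [exact: DC|apply/eqP => v00; rewrite v00 in Dv0].
have Q0 : 0 <= F w := dotvv_ge0 _.
rewrite ltNge; apply/negP => x0.
set P := F v0 in P0 *; set Q := F w in Q0 *; set x := dotv _ _ in x0.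
have PQ : 0 < P + Q by rewrite ltr_pwDl.
(* If x <= 0, the step a minimises the bound a^2 Q + (1 - a)^2 P on F at
   the point a w + (1 - a) v0 of D, and brings it down to
   P Q / (P + Q) < P, against the minimality of v0. *)
pose a := P / (P + Q).
have a01 : 0 <= a <= 1.
  by rewrite divr_ge0 ?(ltW P0) ?(ltW PQ)//= ler_pdivrMr// mul1r lerDl.
have := v0min _ (Dconv _ _ a a01 Dw Dv0).
rewrite /= Tlin TZ !(dotvDr, dotvDl, dotvZr, dotvZl) (dotvC (T w) (T v0)).
rewrite -/(F v0) -/(F w) -/x -/P -/Q.
have aE : a * (P + Q) = P by rewrite /a divfK// gt_eqF.
have : a * (a * Q) + (1 - a) * ((1 - a) * P) < P.
  have -> : a * (a * Q) + (1 - a) * ((1 - a) * P) =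
            P * (1 - a) - a * P + a * (a * (P + Q)) by ring.
  rewrite aE; have : 0 < a by rewrite divr_gt0.
  by nra.
have := mulr_ge0_le0 (mulr_ge0 (andP a01).1 (_ : 0 <= 1 - a)) x0.
rewrite subr_ge0 => /(_ (andP a01).2).
lra.
Qed.

End Separation.

(** * Arbitrary norms and convex cones *)

Section NormFacts.
Context {R : realType} {n : nat} (N : 'cV[R]_n -> R) (hN : is_norm N).

Lemma is_norm0 : N 0 = 0.
Proof. by rewrite -(scale0r 0) is_norm_scale// normr0 mul0r. Qed.

Lemma is_normN v : N (- v) = N v.
Proof. by rewrite -scaleN1r is_norm_scale// normrN1 mul1r. Qed.

Lemma is_norm_ge0 v : 0 <= N v.
Proof.
have := is_norm_triangle hN v (- v).
by rewrite subrr is_norm0 is_normN -mulr2n pmulrn_lge0.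
Qed.

Lemma is_norm_le_mx_norm : exists M, forall v, N v <= M * `|v|.
Proof.
exists (\sum_i N (delta_mx i 0)) => v.
have -> : v = \sum_i v i 0 *: delta_mx i 0.
  by rewrite [LHS]matrix_sum_delta; apply: eq_bigr => i _; rewrite big_ord1.
have Nsum (r : seq 'I_n) (f : 'I_n -> 'cV[R]_n) :
    N (\sum_(i <- r) f i) <= \sum_(i <- r) N (f i).
  elim: r => [|i r IHr]; first by rewrite !big_nil is_norm0.
  by rewrite !big_cons (le_trans (is_norm_triangle hN _ _))// lerD2l.
apply: le_trans (Nsum _ _) _; rewrite mulr_suml; apply: ler_sum => i _.
rewrite is_norm_scale// mulrC ler_wpM2l ?is_norm_ge0//.
have -> : \sum_i0 v i0 0 *: delta_mx i0 0 = v.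
  by rewrite [RHS]matrix_sum_delta; apply: eq_bigr => j _; rewrite big_ord1.
rewrite [leRHS]/Num.norm/= mx_normrE.
by apply: (le_bigmax _ (fun ij : 'I_n * 'I_1 => `|v ij.1 ij.2|) (i, 0)).
Qed.

(** N is Lipschitz for the sup norm. *)
Lemma is_norm_continuous : continuous N.
Proof.
have [M NM] := is_norm_le_mx_norm.
have M1 : 0 < `|M| + 1 by rewrite ltr_wpDl.
move=> v; apply/(@cvgrPdist_lt _ _ _ _ (nbhs_filter v)) => e e0.
have : \forall w \near v, `|v - w| < e / (`|M| + 1).
  by apply/nbhs_normP; exists (e / (`|M| + 1)); rewrite //= divr_gt0.
apply: filterS => w; rewrite ltr_pdivlMr// => vw.
apply: le_lt_trans vw.
have Nvw : N (v - w) <= `|v - w| * (`|M| + 1).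
  apply: le_trans (NM _) _; rewrite mulrC ler_wpM2l//.
  by rewrite (le_trans (ler_norm _))// lerDl.
have := is_norm_triangle hN (v - w) w; rewrite subrK => h1.
have := is_norm_triangle hN (w - v) v; rewrite subrK -opprB is_normN => h2.
rewrite ler_norml; apply/andP; split; lra.
Qed.

End NormFacts.

Section ConvexCones.
Context {R : realType} {m : nat} (K : set 'cV[R]_m).
Hypotheses (coneK : is_cone K) (convexK : convex_set K).

Lemma convex_coneD u v : K u -> K v -> K (u + v).
Proof.
move=> Ku Kv.
have half0 : 0 <= 2^-1 :> R by rewrite invr_ge0.
have half1 : 2^-1 <= 1 :> R by rewrite invf_le1// ler1n.
have mid : K (2^-1 *: u + (1 - 2^-1) *: v).
  by have := @convexK u v (Itv01 half0 half1); rewrite !inE; exact.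
have := coneK (ler0n R 2) mid; congr (K _); rewrite scalerDr !scalerA.
have -> : 2 * (1 - 2^-1) = 1 :> R by lra.
by rewrite mulfV ?pnatr_eq0// !scale1r.
Qed.

Lemma cone0 : K !=set0 -> K 0.
Proof. by move=> [v Kv]; rewrite -(scale0r v); exact: coneK. Qed.

End ConvexCones.

(** Turns a strict inequality along a ray of a cone into the sign condition that
    defines the dual cone. *)
Lemma affine_pos_slope {R : realType} (p r : R) :
  (forall a, 0 <= a -> 0 < a * p + r) -> 0 <= p.
Proof.
move=> H; rewrite leNgt; apply/negP => p0.
have r0 : 0 < r by have := H 0 (lexx _); rewrite mul0r add0r.
have := H (- (r / p)); rewrite mulNr divfK ?lt_eqF// addNr ltxx => F.
by suff : false by []; apply: F; rewrite oppr_ge0 ltW// pmulr_rlt0// invr_lt0.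
Qed.

(** * A theorem of the alternative for conic systems *)

Section Alternative.
Context {R : realType} {n l h : nat}.
Variables (K : set 'cV[R]_l) (Kbar : set 'cV[R]_h).
Hypotheses (coneK : is_cone K) (closedK : closed K) (convexK : convex_set K).
Hypotheses (coneKbar : is_cone Kbar) (closedKbar : closed Kbar)
  (convexKbar : convex_set Kbar).
Hypotheses (K0 : K 0) (Kbar0 : Kbar 0).
Variables (H A : 'M[R]_(l, n)) (c : 'cV[R]_l) (G : 'M[R]_(h, n)) (g : 'cV[R]_h).
Variables (N : 'cV[R]_n -> R) (d : R).
Hypotheses (hN : is_norm N) (d0 : 0 <= d).
Hypothesis no_recession : forall y, Kbar (- (G *m y)) -> y = 0.
Hypothesis infeasible : forall y s,
  N s <= d -> Kbar (g - G *m y) -> ~ K (c - (H *m y + A *m s)).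

(** A vector of V is (y, s, (k, k'), tau), with k and k' the slacks of the two
    conic constraints and tau the homogenising coordinate. *)
Let V : normedModType R :=
  ('cV[R]_n * 'cV[R]_n * ('cV[R]_l * 'cV[R]_h) * R^o)%type.

Let py (v : V) : 'cV[R]_n := v.1.1.1.
Let ps (v : V) : 'cV[R]_n := v.1.1.2.
Let pk (v : V) : 'cV[R]_l := v.1.2.1.
Let pk' (v : V) : 'cV[R]_h := v.1.2.2.
Let pt (v : V) : R := v.2.

Let C : set V :=
  [set v | [/\ K (pk v), Kbar (pk' v), 0 <= pt v & N (ps v) <= pt v * d]].

Let T (v : V) : 'cV[R]_(l + h) :=
  col_mx (H *m py v + A *m ps v + pk v - pt v *: c)
         (G *m py v + pk' v - pt v *: g).

Let pyc : continuous py.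
Proof. by do 3!apply: continuous_fst; move=> v; exact: cvg_id. Qed.

Let psc : continuous ps.
Proof.
by apply: continuous_snd; do 2!apply: continuous_fst; move=> v; exact: cvg_id.
Qed.

Let pkc : continuous pk.
Proof.
apply: continuous_fst; apply: continuous_snd; apply: continuous_fst.
by move=> v; exact: cvg_id.
Qed.

Let pkc' : continuous pk'.
Proof.
by do 2!apply: continuous_snd; apply: continuous_fst; move=> v; exact: cvg_id.
Qed.

Let ptc : continuous pt.
Proof. by apply: continuous_snd; move=> v; exact: cvg_id. Qed.

Let Tc : continuous T.
Proof.
apply: continuous_col_mx => v.
  apply: cvgB; last by apply: cvgZ; [exact: ptc|exact: cvg_cst].
  apply: cvgD; last exact: pkc.
  by apply: cvgD; [apply: (continuous_mulmx pyc)|apply: (continuous_mulmx psc)].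
apply: cvgB; last by apply: cvgZ; [exact: ptc|exact: cvg_cst].
by apply: cvgD; [apply: (continuous_mulmx pyc)|exact: pkc'].
Qed.

Let Tlin : linear T.
Proof.
move=> a u v; rewrite /T scale_col_mx add_col_mx.
rewrite /py /ps /pk /pk' /pt /=.
congr col_mx; rewrite !mulmxDr -!scalemxAr !scalerDl -!scalerA;
  by rewrite !(scalerDr, scalerBr); apply/matrixP => i j; rewrite !mxE; ring.
Qed.

Let coneC (a : R) v : 0 <= a -> C v -> C (a *: v).
Proof.
move=> a0 [kv kv' tv sv].
split; [exact: coneK|exact: coneKbar|exact: mulr_ge0|].
by rewrite is_norm_scale// ger0_norm// -mulrA ler_wpM2l.
Qed.

Let closedC : closed C.
Proof.
rewrite (_ : C = pk @^-1` K `&` (pk' @^-1` Kbar `&`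
    (pt @^-1` [set x | 0 <= x] `&`
     (fun v => pt v * d - N (ps v)) @^-1` [set x | 0 <= x]))); last first.
  apply/seteqP; split => v; rewrite /C/= subr_ge0; first by case.
  by case=> ? [? []].
apply: closedI; first by apply: preimage_closed closedK => v _; exact: pkc.
apply: closedI; first by apply: preimage_closed closedKbar => v _; exact: pkc'.
apply: closedI.
  by apply: preimage_closed (@closed_ge _ _) => v _; exact: ptc.
apply: preimage_closed (@closed_ge _ _) => v _.
apply: cvgB; first by apply: cvgM; [exact: ptc|exact: cvg_cst].
by apply: continuous_comp; [exact: psc|exact: is_norm_continuous].
Qed.

(** For tau > 0, dividing by tau solves the infeasible system; for tau = 0 the
    bound N s <= tau d kills s, and y is a recession direction. *)
Let Tker v : C v -> T v = 0 -> v = 0.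
Proof.
move: v => [[[y s] [k k']] t] [/= kv kv' tv sv].
rewrite /T /py /ps /pk /pk' /pt /= in kv kv' tv sv *.
rewrite -[0]col_mx0 => /eq_col_mx [e1 e2].
have [t0|t0] := eqVneq t 0.
  move: sv e1 e2; rewrite t0 mul0r !scale0r !subr0 => s0 e1 e2.
  have {}s0 : s = 0.
    by apply: (is_norm_eq0 hN); apply/eqP; rewrite eq_le s0 is_norm_ge0.
  have k'E : k' = - (G *m y) by apply/eqP; rewrite -addr_eq0 addrC e2.
  have y0 : y = 0 by apply: no_recession; rewrite -k'E.
  move: e1; rewrite k'E y0 s0 !mulmx0 !add0r oppr0 => ->; by [].
have tpos : 0 < t by rewrite lt_neqAle eq_sym t0.
exfalso; apply: (@infeasible (t^-1 *: y) (t^-1 *: s)).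
- rewrite is_norm_scale// ger0_norm ?invr_ge0// mulrC ler_pdivrMr// mulrC//.
- have -> : g - G *m (t^-1 *: y) = t^-1 *: k'.
    have -> : k' = t *: g - G *m y.
      by apply: subr0_eq; rewrite -[RHS]e2 opprB addrCA addrA.
    by rewrite scalerBr scalerA mulVf// scale1r scalemxAr.
  by apply: coneKbar; rewrite ?invr_ge0.
have -> : c - (H *m (t^-1 *: y) + A *m (t^-1 *: s)) = t^-1 *: k.
  have -> : k = t *: c - (H *m y + A *m s).
    by apply: subr0_eq; rewrite -[RHS]e1 opprB addrCA addrA.
  by rewrite scalerBr scalerA mulVf// scale1r scalerDr !scalemxAr.
by apply: coneK; rewrite ?invr_ge0.
Qed.

Let slice_separation : exists q : 'cV[R]_(l + h),
  forall v, C v -> pt v = 1 -> 0 < dotv q (T v).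
Proof.
pose D := C `&` pt @^-1` [set x | x = 1].
have properV : proper_normed V.
  apply: proper_prod (proper_scalar).
  by do !apply: proper_prod; exact: proper_cV.
have closedD : closed D.
  apply: closedI => //.
  by apply: preimage_closed (@closed_eq _ _) => v _; exact: ptc.
have D0 : ~ D 0 by case=> _ /eqP; rewrite eq_sym oner_eq0.
have Dconv u v (a : R) : 0 <= a <= 1 -> D u -> D v -> D (a *: u + (1 - a) *: v).
  move=> /andP[a0 a1] [Cu u1] [Cv v1].
  have a1' : 0 <= 1 - a by rewrite subr_ge0.
  have [Ku Ku' tu su] := coneC a0 Cu.
  have [Kv Kv' tv sv] := coneC a1' Cv.
  split; last by rewrite /= /pt /= -!/(pt _) u1 v1; rewrite /GRing.scale/=; lra.
  split; [exact: convex_coneD|exact: convex_coneD|exact: addr_ge0|].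
  apply: le_trans (is_norm_triangle hN _ _) _.
  by apply: le_trans (lerD su sv) _; rewrite -mulrDl.
have [q qT] := image_separation properV closedC coneC Tlin Tc Tker closedD
  (@subIsetl _ _ _) D0 Dconv.
by exists q => v Cv v1; apply: qT.
Qed.

(** Each conclusion is read off the separating inequality of [slice_separation]
    by letting one of the four variables vary: k and k' along rays give the dual
    cone conditions, y along a line gives the linear equation, and s gives the
    final strict inequality. *)
Lemma conic_alternative : exists (lam : 'cV[R]_l) (mu : 'cV[R]_h),
  [/\ dual_cone K lam, dual_cone Kbar mu, G^T *m mu + H^T *m lam = 0 &
      forall s, N s <= d -> 0 < - dotv g mu - dotv c lam + dotv (A^T *m lam) s].
Proof.
have [q qT] := slice_separation.
pose lam := usubmx q; pose mu := dsubmx q.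
have sep y s k k' : N s <= d -> K k -> Kbar k' ->
    0 < dotv (G^T *m mu + H^T *m lam) y + dotv (A^T *m lam) s
        + dotv lam k + dotv mu k' - dotv g mu - dotv c lam.
  move=> sd Kk Kk'.
  have Cv : C (y, s, (k, k'), 1) by split=> //=; rewrite mul1r.
  have := qT _ Cv erefl; rewrite /T -[q]vsubmxK dotv_col_mx.
  rewrite /py /ps /pk /pk' /pt /= !scale1r !(dotvBr, dotvDr) !dotv_mulmx.
  by rewrite dotvDl (dotvC g) (dotvC c) -/lam -/mu; lra.
have N0 : N 0 <= d by rewrite is_norm0.
pose r := - dotv g mu - dotv c lam.
exists lam, mu; split.
- move=> k Kk; apply: (@affine_pos_slope _ _ r) => a a0.
  have := sep 0 0 (a *: k) 0 N0 (coneK a0 Kk) Kbar0.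
  by rewrite !dotv0r dotvZr /r; lra.
- move=> k Kk; apply: (@affine_pos_slope _ _ r) => a a0.
  have := sep 0 0 0 (a *: k) N0 K0 (coneKbar a0 Kk).
  by rewrite !dotv0r dotvZr /r; lra.
- set z := _ + _; apply: dotvv_eq0; apply/eqP; rewrite eq_le dotvv_ge0 andbT.
  rewrite -oppr_ge0; apply: (@affine_pos_slope _ _ r) => a _.
  have := sep (- (a *: z)) 0 0 0 N0 K0 Kbar0.
  by rewrite -/z dotvNr dotvZr !dotv0r /r; lra.
- move=> s sd; have := sep 0 s 0 0 sd K0 Kbar0.
  by rewrite !dotv0r; lra.
Qed.
End Alternative.

(** * Conic sets and dual norms *)

(** Such a y spans a ray contained in the bounded conic set. *)
Lemma compact_no_recession {R : realType} (n h : nat) (Kbar : set 'cV[R]_h)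
    (G : 'M[R]_(h, n)) (g : 'cV[R]_h) :
  is_cone Kbar -> convex_set Kbar -> compact (conic_set Kbar G g) ->
  conic_set Kbar G g !=set0 -> forall y, Kbar (- (G *m y)) -> y = 0.
Proof.
move=> coneK convK cB [y0 By0] y Ky.
have [M [_ HM]] := compact_bounded cB.
pose M' := M + 1.
have bnd z : conic_set Kbar G g z -> `|z| <= M'.
  by move=> Bz; apply: (HM M' _ z Bz); rewrite ltrDl.
have ray (a : R) : 0 <= a -> `|y0 + a *: y| <= M'.
  move=> a0; apply: bnd; rewrite /conic_set/= /cone_le mulmxDr opprD addrA.
  by apply: convex_coneD => //; rewrite -scalemxAr -scalerN; exact: coneK.
apply/eqP; rewrite -normr_le0.
rewrite -oppr_ge0; apply: (@affine_pos_slope _ _ (M' + `|y0| + 1)) => a a0.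
have := ler_normB (y0 + a *: y) y0.
rewrite addrAC subrr add0r normrZ ger0_norm//; have := ray _ a0.
lra.
Qed.

Lemma dotv_le_dual_norm {R : realType} (n : nat) (N : 'cV[R]_n -> R) z s :
  is_norm N -> (dual_norm N z <= 1)%E -> dotv z s <= N s.
Proof.
move=> hN hz.
have [Ns0|Ns0] := eqVneq (N s) 0.
  by rewrite (is_norm_eq0 hN Ns0) dotv0r is_norm0.
have Ns : 0 < N s by rewrite lt_neqAle eq_sym Ns0 is_norm_ge0.
rewrite -[leRHS]mul1r -ler_pdivrMr// mulrC -dotvZr -lee_fin.
apply: le_trans hz; apply: ereal_sup_ubound; exists ((N s)^-1 *: s) => //=.
by rewrite is_norm_scale// gtr0_norm ?invr_gt0// mulVf.
Qed.

(** * Distance between the object and the obstacle *)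

Theorem proposition3 (R : realType) (n nx l h : nat)
    (A : 'M[R]_(l, n)) (b : 'cV[R]_l) (K : set 'cV[R]_l)
    (G : 'M[R]_(h, n)) (g : 'cV[R]_h) (Kbar : set 'cV[R]_h)
    (Rot : 'cV[R]_nx -> 'M[R]_n) (t : 'cV[R]_nx -> 'cV[R]_n)
    (N : 'cV[R]_n -> R) (dmin : R) (x : 'cV[R]_nx)
    (Obs := conic_set K A b) (B := conic_set Kbar G g)
    (E := fun x' : 'cV[R]_nx => [set Rot x' *m y + t x' | y in B])
    (hK : closed_convex_pointed_cone K) (hK0 : interior K !=set0)
    (hOconvex : convex_set Obs) (hOcompact : compact Obs)
    (hO0 : relative_interior Obs !=set0)
    (hKbar : closed_convex_pointed_cone Kbar)
    (hBconvex : convex_set B) (hBcompact : compact B)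
    (hB0 : relative_interior B !=set0)
    (hRotsmooth : smooth Rot) (htsmooth : smooth t)
    (hRot : forall x' : 'cV[R]_nx, rotation_mx (Rot x'))
    (hN : is_norm N) (hdmin : 0 <= dmin) :
  (dmin%:E < set_dist N (E x) Obs)%E <->
  exists (lam : 'cV[R]_l) (mu : 'cV[R]_h),
    [/\ cone_le (dual_cone K) 0 lam,
        cone_le (dual_cone Kbar) 0 mu,
        dmin < - dotv g mu + dotv (A *m t x - b) lam,
        G^T *m mu + (Rot x)^T *m A^T *m lam = 0 &
        (dual_norm N (A^T *m lam) <= 1)%E].
Proof.
have [coneK closedK convK _] := hK.
have [coneKbar closedKbar convKbar _] := hKbar.
have K0 : K 0.
  by apply: cone0 => //; have [k /interior_subset ?] := hK0; exists k.
have B0 : B !=set0 by have [y []] := hB0; exists y.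
have Kbar0 : Kbar 0.
  by apply: cone0 => //; have [y By] := B0; exists (g - G *m y).
pose val lam mu := - dotv g mu + dotv (A *m t x - b) lam.
split=> [dist_gt|[lam [mu]]]; last first.
  rewrite /cone_le !subr0 -/(val lam mu) => -[lamK muK valgt orth lam1].
  apply: (@lt_le_trans _ _ (val lam mu)%:E); first by rewrite lte_fin.
  apply: le_ereal_inf_tmp => _ [s [_ [[_ [y By <-] <-] Oy]] <-].
  rewrite lee_fin -(is_normN hN).
  apply: le_trans (dotv_le_dual_norm (- s) hN lam1).
  have := lamK _ Oy; have := muK _ By.
  have orthy : dotv mu (G *m y) + dotv lam (A *m (Rot x *m y)) = 0.
    by rewrite !dotv_mulmx mulmxA -dotvDl orth dotvC dotv0r.
  rewrite /val !mulmxDr !(dotvBr, dotvDr) dotvNr -(dotv_mulmx A lam) (dotvC g).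
  by rewrite (dotvC _ lam) !(dotvBr, dotvDr); lra.
(* The strict gap gives d > 0 even when dmin = 0, so that the bound on the ball
   of radius d controls the dual norm. *)
have [d dmin_d d_dist] : exists2 d, dmin < d & (d%:E < set_dist N (E x) Obs)%E.
  move: dist_gt; case: (set_dist N (E x) Obs) => [r| |]//.
    rewrite lte_fin => dr; exists ((dmin + r) / 2); rewrite ?lte_fin; lra.
  by exists (dmin + 1); rewrite ?ltry//; lra.
have d0 : 0 < d by exact: le_lt_trans dmin_d.
have infeasible y s : N s <= d -> Kbar (g - G *m y) ->
    ~ K ((b - A *m t x) - (A *m Rot x *m y + A *m s)).
  move=> sd By Ks.
  suff : (set_dist N (E x) Obs <= d%:E)%E by rewrite leNgt d_dist.
  apply: (@le_trans _ _ (N s)%:E); last by rewrite lee_fin.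
  apply: ereal_inf_lbound; exists s => //; exists (Rot x *m y + t x + s).
  split; first by exists (Rot x *m y + t x) => //; exists y.
  rewrite /Obs /conic_set/= /cone_le; congr (K _): Ks.
  rewrite !mulmxDr !mulmxA; apply/matrixP => i j; rewrite !mxE; ring.
have [lam [mu [lamK muK orth sep]]] := conic_alternative coneK closedK convK
  coneKbar closedKbar convKbar K0 Kbar0 hN (ltW d0)
  (compact_no_recession coneKbar convKbar hBcompact B0) infeasible.
have valE : - dotv g mu - dotv (b - A *m t x) lam = val lam mu.
  by rewrite /val !(dotvC _ lam) !dotvBr; lra.
rewrite valE in sep.
have val0 : 0 < val lam mu.
  by have := sep 0; rewrite is_norm0// dotv0r addr0 => /(_ (ltW d0)).
(* This factor makes the dual objective equal to d. *)
pose a := d / val lam mu.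
have a0 : 0 < a by rewrite divr_gt0.
exists (a *: lam), (a *: mu); rewrite /cone_le !subr0; split.
- by move=> k Kk; rewrite dotvZl mulr_ge0 ?(ltW a0)//; exact: lamK.
- by move=> k Kk; rewrite dotvZl mulr_ge0 ?(ltW a0)//; exact: muK.
- by rewrite !dotvZr -mulrN -mulrDr -/(val lam mu) divfK ?gt_eqF.
- by rewrite -!scalemxAr -scalerDr -trmx_mul orth scaler0.
- apply: ge_ereal_sup => _ [y /= Ny <-]; rewrite lee_fin -scalemxAr dotvZl.
  have := sep (- (d *: y)); rewrite is_normN// is_norm_scale// gtr0_norm//.
  rewrite ler_piMr ?(ltW d0)// dotvNr dotvZr => /(_ isT) sepy.
  rewrite /a mulrAC ler_pdivrMr// mul1r; lra.
Qed.
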